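(* Let $T>0$. For every $\varepsilon>0$ let $(U_n^\varepsilon)_{n\ge 1}$ be a sequence of i.i.d. random variables such that $U_1^\varepsilon$ has the same distribution as $\varepsilon^2 U$, where $U$ is a positive random variable which does not depend on $\varepsilon$. Put $s_n^\varepsilon=\sum_{i=1}^n U_i^\varepsilon$ and $N_T^\varepsilon=\inf\{n\ge 1:\ s_n^\varepsilon\ge T\}$. 1. If there exist two constants $C>0$ and $\kappa>0$ such that $\mathbb{E}[e^{-\lambda U}]\le \frac{C}{\lambda^\kappa}$ for all $\lambda>0$, then for every $\varepsilon>0$ $$\mathbb{P}(N_T^\varepsilon>j)\le \left(\frac{eT\,C^{1/\kappa}}{j\kappa\varepsilon^2}\right)^{j\kappa},\qquad \forall j\in\mathbb{N},\ j\ge 1.$$ 2. If $\mathbb{E}[U^2]<\infty$, then for any $\delta>1$ there exists $\varepsilon_0>0$ such that $$\mathbb{E}[N_T^\varepsilon]\le \frac{\delta e T}{\varepsilon^2\,\mathbb{E}[U]},\qquad \forall\, 0<\varepsilon\le\varepsilon_0.$$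
   Context: Here $e$ denotes Euler's number. The variables $U_n^\varepsilon$ play the role of the lengths of successive random time steps, $s_n^\varepsilon$ is the time reached after $n$ steps, and $N_T^\varepsilon$ is the number of steps needed to cover $[0,T]$. *)

(* Defs.v *)
From mathcomp Require Import all_boot all_order all_algebra.
From mathcomp Require Import all_classical all_reals all_analysis.
Import Order.TTheory GRing.Theory Num.Theory.
Import numFieldNormedType.Exports.

Set Implicit Arguments.
Unset Strict Implicit.
Unset Printing Implicit Defensive.

Local Open Scope classical_set_scope.
Local Open Scope ring_scope.

Section random_variables.
Context {d d' : measure_display} {Omega : measurableType d}
  {E : measurableType d'} {R : realType} (P : probability Omega R).

                                                                          
                                                                         
Definition same_distribution (X Y : Omega -> E) : Prop :=
  forall A : set E, measurable A -> pushforward P X A = pushforward P Y A.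

Definition mutually_independent (I : eqType) (X : I -> Omega -> E) : Prop :=
  forall (J : seq I) (A : I -> set E), uniq J ->
    (forall i, i \in J -> measurable (A i)) ->
    P (\bigcap_(i in [set` J]) (X i @^-1` A i)) =
      (\prod_(i <- J) P (X i @^-1` A i))%E.

Definition iid (I : eqType) (X : I -> Omega -> E) : Prop :=
  mutually_independent X /\ forall i j, same_distribution (X i) (X j).

End random_variables.

Section random_time_steps.
Context {Omega : Type} {R : realType}.

                                                                         
                                                           
Definition time_reached (X : nat -> Omega -> R) (n : nat) (w : Omega) : R :=
  \sum_(i < n) X i w.

                                                                        
Definition num_steps (X : nat -> Omega -> R) (T : R) (w : Omega) : \bar R :=
  ereal_inf [set (n%:R)%:E | n in
    [set n : nat | (1 <= n)%N /\ T <= time_reached X n w]].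

End random_time_steps.

(* Main.v *)
(* For [j >= 1], [N > j] forces [s_j < T], so the indicator of [N > j] is at most
   [exp(l (T - s_j))] for every [l >= 0].  By independence this has mean
   [exp(l T) phi^j], where [phi = E exp(-l U_1)].  Part 1 follows by taking
   [l = j kappa / T].  For part 2, take [l = 1/T] and sum over [j >= 0]: the mean
   of [N] is at most [e / (1 - phi)], and [exp(-x) <= 1 - x + x^2] gives
   [1 - phi >= (eps^2/T) E U - (eps^2/T)^2 E U^2]. *)
Require Import Defs.
From mathcomp Require Import all_boot all_order all_algebra.
From mathcomp Require Import all_classical all_reals all_analysis.
From mathcomp Require Import measurable_realfun ring lra.
Import Order.TTheory GRing.Theory Num.Theory.
Import numFieldNormedType.Exports.

Local Open Scope classical_set_scope.
Local Open Scope ring_scope.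

(** The integral of a nonnegative function is a supremum over simple functions below it, and a
    larger function admits more of them. Measurability never enters, so this applies directly to
    [num_steps]. *)
Lemma ge0_le_integralT (d : measure_display) (Omega : measurableType d)
    (R : realType) (mu : {measure set Omega -> \bar R}) (f g : Omega -> \bar R) :
  (forall w, (0 <= f w)%E) -> (forall w, (f w <= g w)%E) ->
  (\int[mu]_w f w <= \int[mu]_w g w)%E.
Proof.
move=> f0 fg; have g0 w : (0 <= g w)%E by exact: le_trans (fg w).
rewrite !ge0_integralTE//; apply: ge_ereal_sup => _ [h hf <-].
by apply: ereal_sup_ubound; exists h => // w; exact: le_trans (fg w).
Qed.

(** * Expectation of a product of functions of independent variables *)

Section independence.
Local Open Scope ereal_scope.
Context {d d' : measure_display} {Omega : measurableType d}
  {E : measurableType d'} {R : realType}.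

Import HBNNSimple.

(** The hypothesis on preimages is the claim for indicators; linearity extends it to simple
    functions and monotone convergence to every nonnegative measurable [f]. The weight [G] is meant
    to carry the other independent factors. *)
Lemma integral_mul_comp (mu : {measure set Omega -> \bar R})
    (X : {mfun Omega >-> E}) (G : Omega -> R) (c : \bar R) :
  measurable_fun [set: Omega] G -> (forall w, 0 <= G w)%R ->
  0 <= c -> c \is a fin_num ->
  (forall A, measurable A ->
    \int[mu]_(w in X @^-1` A) (G w)%:E = c * mu (X @^-1` A)) ->
  forall f : E -> \bar R, measurable_fun [set: E] f -> (forall x, 0 <= f x) ->
    \int[mu]_w ((G w)%:E * f (X w)) = c * \int[mu]_w f (X w).
Proof.
move=> mG0 G0' c0 cfin GX f mf f0.
have mG : measurable_fun [set: Omega] (EFin \o G) by exact/measurable_EFinP.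
have G0 w : 0 <= (G w)%:E by rewrite lee_fin.
have mX A : measurable A -> measurable (X @^-1` A).
  by move=> mA; rewrite -[_ @^-1` _]setTI; exact: measurable_funP.
have simple (h : {nnsfun E >-> R}) :
    \int[mu]_w ((G w)%:E * (h (X w))%:E) = c * \int[mu]_w (h (X w))%:E.
  (* Level-set decomposition: [h (X w)] is the finite sum of [term y w] over the values [y] of
     [h]. *)
  pose term (y : R) w := y%:E * (\1_(X @^-1` (h @^-1` [set y])) w)%:E.
  have mA y : measurable (X @^-1` (h @^-1` [set y])) by exact: mX.
  have mterm y : measurable_fun [set: Omega] (term y).
    by apply/measurable_funeM/measurable_EFinP; exact: measurable_indic.
  have term0 y w : 0 <= term y w by exact: (nnfun_muleindic_ge0 _ _ (X w)).
  have hE w : (h (X w))%:E = \sum_(y \in range h) term y w.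
    by rewrite fimfunE -fsumEFin.
  transitivity (\sum_(y \in range h) \int[mu]_w ((G w)%:E * term y w)).
    rewrite -ge0_integral_fsum//.
    - apply: eq_integral => w _; rewrite hE ge0_mule_fsumr//.
    - by move=> y; apply: emeasurable_funM.
    - by move=> y w _; rewrite mule_ge0.
  under [in RHS]eq_integral do rewrite hE.
  rewrite ge0_integral_fsum// ge0_mule_fsumr; last first.
    by move=> y; exact: integral_ge0.
  apply: eq_fsbigr => y /[!inE] -[x _ <-].
  have hx0 : 0 <= (h x)%:E by rewrite lee_fin.
  under eq_integral do rewrite /term muleCA.
  rewrite ge0_integralZl//; last 2 first.
  - by apply: emeasurable_funM => //; exact/measurable_EFinP/measurable_indic.
  - by move=> w _; rewrite mule_ge0// lee_fin.
  rewrite /term ge0_integralZl//; last first.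
    exact/measurable_EFinP/measurable_indic.
  rewrite muleCA integral_indic// setIT -GX//; congr (_ * _).
  by rewrite [RHS]integral_mkcond epatch_indic.
pose h := nnsfun_approx measurableT mf.
have hf w : (h n (X w))%:E @[n --> \oo] --> f (X w).
  by apply: (@cvg_nnsfun_approx _ _ _ _ measurableT _ mf _ (X w)).
have ndh w : nondecreasing_seq (fun n => (h n (X w))%:E).
  by move=> m n mn; rewrite lee_fin; exact/lefP/nd_nnsfun_approx.
have mh n : measurable_fun [set: Omega] (fun w => (h n (X w))%:E).
  by apply/measurable_EFinP/measurableT_comp.
have h0 n w : 0 <= (h n (X w))%:E by rewrite lee_fin.
(* Monotone convergence is used on both sides; the finiteness of [c] lets it leave the limit. *)
transitivity (limn (fun n => \int[mu]_w ((G w)%:E * (h n (X w))%:E))).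
  rewrite -monotone_convergence//.
  - apply: eq_integral => w _; apply/esym/cvg_lim => //.
    exact: cvgeZl.
  - by move=> n; exact: emeasurable_funM.
  - by move=> n w _; rewrite mule_ge0.
  - by move=> w _ m n mn; rewrite lee_wpmul2l// ndh.
under eq_fun do rewrite simple.
rewrite limeMl//; last first.
  apply: ereal_nondecreasing_is_cvgn => m n mn.
  by apply: ge0_le_integral => // w _; exact: ndh.
rewrite -monotone_convergence//.
by congr (_ * _); apply: eq_integral => w _; exact/cvg_lim.
Qed.

(* The factors [f i (X i)] are introduced one at a time: the induction hypothesis
   handles an arbitrary event on the remaining variables, which is what
   [integral_mul_comp] needs to replace an indicator by a function. *)
Lemma integral_prod_comp_indep (P : probability Omega R) (I : eqType)
    (X : I -> {mfun Omega >-> E}) (f : I -> E -> R) (J : seq I) :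
  mutually_independent P (fun i => X i : Omega -> E) ->
  (forall i, measurable_fun [set: E] (f i)) ->
  (forall i x, 0 <= f i x)%R ->
  (forall i, \int[P]_w (f i (X i w))%:E < +oo) ->
  uniq J ->
  \int[P]_w (\prod_(i <- J) f i (X i w))%:E =
    \prod_(i <- J) \int[P]_w (f i (X i w))%:E.
Proof.
move=> indX mf f0 foo.
have mX i A : measurable A -> measurable (X i @^-1` A).
  by move=> mA; rewrite -[_ @^-1` _]setTI; exact: measurable_funP.
have mfX i : measurable_fun [set: Omega] (fun w => f i (X i w)).
  exact: measurableT_comp.
have intf0 i : 0 <= \int[P]_w (f i (X i w))%:E.
  by apply: integral_ge0 => w _; rewrite lee_fin.
suff aux K (A : I -> set E) : uniq (J ++ K) ->
    (forall i, i \in K -> measurable (A i)) ->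
    \int[P]_(w in \bigcap_(i in [set` K]) (X i @^-1` A i))
        (\prod_(i <- J) f i (X i w))%:E =
      \prod_(i <- J) \int[P]_w (f i (X i w))%:E *
      \prod_(i <- K) P (X i @^-1` A i).
  move=> uJ; have := aux [::] (fun=> setT).
  rewrite cats0 set_nil bigcap_set0 big_nil mule1; exact.
(* For empty [J] the integrand is 1, and the claim is mutual independence itself. *)
elim: J K A => [|j J IH] K A uK mA.
  rewrite big_nil mul1e -indX//; under eq_integral do rewrite big_nil.
  rewrite integral_cst ?mul1e//.
  by apply: fin_bigcap_measurable => [|i /= iK]; [exact: finite_seq|exact/mX/mA].
have jK : j \notin K.
  by move: uK; rewrite /= mem_cat negb_or => /andP[/andP[]].
have uJK : uniq (J ++ K) by move: uK => /= /andP[].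
set S := \bigcap_(i in _) _.
have mS : measurable S.
  by apply: fin_bigcap_measurable => [|i /= iK]; [exact: finite_seq|exact/mX/mA].
set c := \prod_(i <- J) \int[P]_w (f i (X i w))%:E * \prod_(i <- K) P (X i @^-1` A i).
have c0 : 0 <= c by rewrite mule_ge0// prode_ge0.
have cfin : c \is a fin_num.
  rewrite fin_numM//; first by apply: prode_fin_num => i _; rewrite ge0_fin_numE.
  rewrite big_seq; apply: prode_fin_num => i iK.
  by rewrite fin_num_measure//; exact/mX/mA.
rewrite integral_mkcond.
(* Everything except the factor of index [j] becomes the weight; by induction its integral is
   [c]. *)
pose G w : R := ((\prod_(i <- J) f i (X i w)) * \1_S w)%R.
transitivity (\int[P]_w ((G w)%:E * (f j (X j w))%:E)).
  apply: eq_integral => w _; rewrite epatch_indic/= /G big_cons -!EFinM; congr EFin.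
  by rewrite [X in (X * _)%R]mulrC mulrAC.
rewrite (@integral_mul_comp P (X j) G c _ _ _ _ _ (EFin \o f j))//.
- by rewrite big_cons /c muleC muleA.
- apply: measurable_funM; last exact: measurable_indic.
  by apply: measurable_prod => i _.
- by move=> w; rewrite mulr_ge0// prodr_ge0.
- move=> B mB.
  (* The event [B] on [X j] joins those indexed by [K], so the induction hypothesis is used with
     [j :: K]. As [j] is not in [K], the other events are unchanged. *)
  pose A' i := if i == j then B else A i.
  have A'K i : i \in K -> A' i = A i.
    by rewrite /A'; case: eqP => // -> jK'; rewrite jK' in jK.
  have A'j : A' j = B by rewrite /A' eqxx.
  have A'KE : \prod_(i <- K) P (X i @^-1` A' i) = \prod_(i <- K) P (X i @^-1` A i).
    by apply: eq_big_seq => i iK; rewrite A'K.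
  have := IH (j :: K) A'; rewrite big_cons A'j A'KE muleCA muleC => <-.
  + rewrite integral_mkcond [RHS]integral_mkcond !epatch_indic.
    have -> : \bigcap_(i in [set` j :: K]) (X i @^-1` A' i) = S `&` X j @^-1` B.
      apply/seteqP; split => [w h|w [Sw Bw] i /=].
        split=> [i /= iK|]; last by rewrite -A'j; apply: h; rewrite /= mem_head.
        by rewrite -A'K//; apply: h; rewrite /= inE iK orbT.
      rewrite inE => /predU1P[->|iK]; first by rewrite A'j.
      by rewrite A'K//; exact: Sw.
    by apply: eq_integral => w _; rewrite indicI /G -!EFinM mulrA.
  + by rewrite -cat1s uniq_catCA cat1s.
  + by move=> i; rewrite inE /A'; case: eqP => //= _; exact: mA.
- exact/measurable_EFinP.
- by move=> x; rewrite lee_fin.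
Qed.
End independence.

(** * Laws of the steps and Laplace transform of the time reached *)

Section time_steps.
Context {d : measure_display} {Omega : measurableType d} {R : realType}.
Variable P : probability Omega R.

Lemma same_distribution_integral (d' : measure_display) (E : measurableType d')
    (X Y : {RV P >-> E}) (f : E -> \bar R) :
  same_distribution P (X : Omega -> E) Y ->
  measurable_fun [set: E] f -> (forall x, (0 <= f x)%E) ->
  (\int[P]_w f (X w) = \int[P]_w f (Y w))%E.
Proof.
move=> XY mf f0; rewrite -(ge0_integral_distribution X)//.
rewrite -(ge0_integral_distribution Y)//.
by apply: eq_measure_integral => A mA _; exact: XY.
Qed.

Lemma measurable_expRN (l : R) :
  measurable_fun [set: R] (fun x => expR (- (l * x))).
Proof.
by apply: measurableT_comp => //; apply: measurableT_comp => //; exact: measurable_funM.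
Qed.

Lemma laplace_time_reached (X : nat -> {RV P >-> R}) (l r : R) (n : nat) :
  iid P (fun i => X i : Omega -> R) ->
  (\int[P]_w (expR (- (l * X 0%N w)))%:E = r%:E)%E ->
  (\int[P]_w (expR (- (l * time_reached X n w)))%:E = (r ^+ n)%:E)%E.
Proof.
move=> [indX idX] X0r.
have Xr i : (\int[P]_w (expR (- (l * X i w)))%:E = r%:E)%E.
  rewrite -X0r; apply: (same_distribution_integral _ _ _ _
    (EFin \o (fun x => expR (- (l * x)))) (idX i 0%N)).
    by apply/measurable_EFinP; exact: measurable_expRN.
  by move=> x; rewrite lee_fin expR_ge0.
transitivity (\int[P]_w (\prod_(i <- index_iota 0 n) expR (- (l * X i w)))%:E)%E.
  apply: eq_integral => w _; congr EFin.
  by rewrite -expR_sum /time_reached mulr_sumr -sumrN big_mkord.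
rewrite (@integral_prod_comp_indep _ _ _ _ _ P _ X (fun _ x => expR (- (l * x))))//.
- elim: n => [|n IH]; first by rewrite big_nil.
  by rewrite big_nat_recr// IH Xr exprSr EFinM.
- by move=> i; exact: measurable_expRN.
- by move=> i; rewrite Xr ltry.
- exact: iota_uniq.
Qed.

(** * Tail and mean of the number of steps *)

(** All indices up to [j] appear, and not [j] alone, because the steps may be negative at some [w]
    and the time reached need not be monotone. *)
Lemma lt_num_stepsP (X : nat -> Omega -> R) (T : R) (w : Omega) (j : nat) :
  (j%:R%:E < num_steps X T w)%E <->
  forall n, (1 <= n <= j)%N -> time_reached X n w < T.
Proof.
split=> [jN n /andP[n1 nj]|h].
  rewrite ltNge; apply/negP => Tn; move: jN; rewrite ltNge => /negP; apply.
  by apply: ge_ereal_inf; exists n%:R%:E; [exists n|rewrite lee_fin ler_nat].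
(* Integrality keeps the inequality strict under the infimum: every admissible index is at least
   [j.+1]. An empty set of indices gives [+oo]. *)
apply: (@lt_le_trans _ _ j.+1%:R%:E); first by rewrite lte_fin ltr_nat.
apply: le_ereal_inf_tmp => _ [n [n1 Tn] <-]; rewrite lee_fin ler_nat ltnNge.
by apply/negP => nj; move: (h n); rewrite n1 nj => /(_ isT); rewrite ltNge Tn.
Qed.

Lemma measurable_time_reached (X : nat -> {RV P >-> R}) (n : nat) :
  measurable_fun [set: Omega] (time_reached X n).
Proof. exact: measurable_sum. Qed.

Lemma measurable_lt_num_steps (X : nat -> {RV P >-> R}) (T : R) (j : nat) :
  measurable [set w | (j%:R%:E < num_steps X T w)%E].
Proof.
rewrite (_ : mkset _ = \bigcap_(n in [set n | (1 <= n <= j)%N])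
    (time_reached X n @^-1` `]-oo, T[)); last first.
  apply/seteqP; split=> w /= h.
    by move=> n /= nj; rewrite in_itv/=; exact: (lt_num_stepsP _ _ _ _).1 h n nj.
  by apply/lt_num_stepsP => n nj; have := h n nj; rewrite /= in_itv.
apply: bigcap_measurableType => n _; rewrite -[X in measurable X]setTI.
exact: measurable_time_reached.
Qed.

Lemma integral_expR_sub_time_reached (X : nat -> {RV P >-> R}) (l r T : R) (n : nat) :
  iid P (fun i => X i : Omega -> R) ->
  (\int[P]_w (expR (- (l * X 0%N w)))%:E = r%:E)%E ->
  (\int[P]_w (expR (l * (T - time_reached X n w)))%:E = (expR (l * T) * r ^+ n)%:E)%E.
Proof.
move=> iidX Xr.
under eq_integral do rewrite mulrBr expRD EFinM.
rewrite ge0_integralZl//.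
- by rewrite (laplace_time_reached _ _ _ n iidX Xr).
- apply/measurable_EFinP; apply: (measurableT_comp (measurable_expRN l)).
  exact: measurable_time_reached.
Qed.

Lemma prob_lt_num_steps_le (X : nat -> {RV P >-> R}) (l r T : R) (j : nat) :
  iid P (fun i => X i : Omega -> R) ->
  (\int[P]_w (expR (- (l * X 0%N w)))%:E = r%:E)%E -> 0 <= l -> (1 <= j)%N ->
  (P [set w | j%:R%:E < num_steps X T w] <= (expR (l * T) * r ^+ j)%:E)%E.
Proof.
move=> iidX Xr l0 j1.
rewrite -(integral_expR_sub_time_reached _ _ _ T j iidX Xr) -[leLHS]mul1e.
rewrite -(setIT [set w | _]) -integral_indic ?mul1e//; last first.
  exact: measurable_lt_num_steps.
apply: ge0_le_integralT => w; rewrite lee_fin// indicE.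
have [wS|_] := boolP (w \in _); last exact: expR_ge0.
move: wS; rewrite inE/= => /lt_num_stepsP/(_ j); rewrite j1 leqnn => /(_ isT) sT.
by rewrite -expR0 ler_expR mulr_ge0// subr_ge0 ltW.
Qed.

(** Each index [n] below the number of steps contributes a term at least 1. Proving this pointwise
    allows a single integration afterwards, and arguing by contradiction also covers the value
    [+oo]. *)
Lemma num_steps_le_nneseries (X : nat -> Omega -> R) (l T : R) (w : Omega) :
  0 <= l -> 0 <= T ->
  (num_steps X T w <= \sum_(0 <= n <oo) (expR (l * (T - time_reached X n w)))%:E)%E.
Proof.
move=> l0 T0; set S := (\sum_(0 <= n <oo) _)%E; rewrite leNgt; apply/negP => SN.
have e0 n : (0 <= (expR (l * (T - time_reached X n w)))%:E)%E.
  by rewrite lee_fin expR_ge0.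
have S0 : (0 <= S)%E by exact: nneseries_ge0.
have Sfin : S \is a fin_num.
  by rewrite ge0_fin_numE// (lt_le_trans SN)// leey.
(* If the sum [S] were below the number of steps, its integer part [k] would be too; then the [k.+1]
   terms of index 0 to [k] are all at least 1, which forces [S] to be at least [k.+1]. *)
set k := Num.truncn (fine S).
have kS : (k%:R <= fine S).
  by rewrite truncn_le// fine_ge0.
have Sk : (fine S < k.+1%:R) by exact: truncnS_gt.
have : (\sum_(0 <= n < k.+1) (expR (l * (T - time_reached X n w)))%:E <= S)%E.
  exact: nneseries_lim_ge.
apply/negP; rewrite -ltNge -[S]fineK//.
apply: (@lt_le_trans _ _ k.+1%:R%:E); first by rewrite lte_fin.
rewrite sumEFin lee_fin -[leLHS]mulr1 -[k.+1 in leLHS]subn0 mulr_natl.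
rewrite -sumr_const_nat; apply: ler_sum_nat => n nk.
rewrite -expR0 ler_expR mulr_ge0// subr_ge0.
(* Index 0 is not covered by [lt_num_stepsP]; there the time reached is 0, at most [T]. *)
case: n nk => [_|n nk]; first by rewrite /time_reached big_ord0.
apply/ltW/(lt_num_stepsP _ _ _ k).1 => //.
apply: le_lt_trans SN; rewrite -[S]fineK// lee_fin.
Qed.

Lemma integral_num_steps_le (X : nat -> {RV P >-> R}) (l r T : R) :
  iid P (fun i => X i : Omega -> R) ->
  (\int[P]_w (expR (- (l * X 0%N w)))%:E = r%:E)%E -> r < 1 ->
  0 <= l -> 0 <= T ->
  (\int[P]_w num_steps X T w <= (expR (l * T) / (1 - r))%:E)%E.
Proof.
move=> iidX Xr r1 l0 T0.
have r0 : 0 <= r.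
  by rewrite -lee_fin -Xr integral_ge0// => w _; rewrite lee_fin expR_ge0.
apply: (@le_trans _ _ (\int[P]_w \sum_(0 <= n <oo) (expR (l * (T - time_reached X n w)))%:E)%E).
  apply: ge0_le_integralT => w; last exact: num_steps_le_nneseries.
  by apply: le_ereal_inf_tmp => _ [n _ <-]; rewrite lee_fin.
rewrite integral_nneseries//; last first.
  move=> n; apply/measurable_EFinP; apply: measurableT_comp => //.
  apply: measurable_funM => //; apply: measurable_funB => //.
  exact: measurable_time_reached.
under eq_eseriesr do rewrite (integral_expR_sub_time_reached _ _ _ _ _ iidX Xr).
apply: lime_le.
  by apply: is_cvg_nneseries => n _ _; rewrite lee_fin mulr_ge0 ?expR_ge0// exprn_ge0.
(* Each partial geometric sum times [1 - r] equals [1 - r ^+ n], hence is at most 1. *)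
apply: nearW => n; rewrite sumEFin lee_fin -mulr_sumr ler_pM2l ?expR_gt0//.
rewrite -div1r ler_pdivlMr ?subr_gt0// mulrC big_mkord.
by rewrite -opprB mulNr -subrX1 opprB lerBlDr lerDl exprn_ge0.
Qed.

(** * Moments of [U] and its Laplace transform near 0 *)

(** Integrates [exp(-x) + x <= 1 + x^2] at [x = l U]. With the linear term on the left and [U]
    replaced by its absolute value, all integrands are nonnegative and no moment has to be
    finite. *)
Lemma laplace_le_quadratic (U : {RV P >-> R}) (l : R) :
  0 <= l -> {ae P, forall w, 0 < U w} ->
  (\int[P]_w (expR (- (l * U w)))%:E + l%:E * \int[P]_w (`|U w|)%:E <=
     1 + (l ^+ 2)%:E * \int[P]_w (U w ^+ 2)%:E)%E.
Proof.
move=> l0 U0.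
have mU1 : measurable_fun [set: Omega] (fun w => (`|U w|)%:E).
  by apply/measurable_EFinP; exact: measurableT_comp.
have mU2 : measurable_fun [set: Omega] (fun w => (U w ^+ 2)%:E).
  by apply/measurable_EFinP; exact: measurable_funX.
have mexp : measurable_fun [set: Omega] (fun w => (expR (- (l * U w)))%:E).
  by apply/measurable_EFinP; exact: (measurableT_comp (measurable_expRN l)).
have lU0 w : (0 <= l%:E * `|U w|%:E)%E by rewrite mule_ge0.
have lU20 w : (0 <= (l ^+ 2)%:E * (U w ^+ 2)%:E)%E.
  by rewrite mule_ge0// lee_fin sqr_ge0.
have mlU : measurable_fun [set: Omega] (fun w => l%:E * (`|U w|)%:E)%E.
  exact: measurable_funeM.
have mlU2 : measurable_fun [set: Omega] (fun w => (l ^+ 2)%:E * (U w ^+ 2)%:E)%E.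
  exact: measurable_funeM.
have exp0 w : (0 <= (expR (- (l * U w)))%:E)%E by rewrite lee_fin expR_ge0.
rewrite -ge0_integralZl_EFin// -ge0_integralD//.
rewrite -ge0_integralZl_EFin ?sqr_ge0//; last by move=> w _; rewrite lee_fin sqr_ge0.
have -> : 1%E = (\int[P]_w (cst 1 w))%E :> \bar R.
  by rewrite integral_cst// mul1e; exact/esym/probability_setT.
rewrite -ge0_integralD//.
apply: ae_ge0_le_integral => //.
- by move=> w _; rewrite adde_ge0 ?mule_ge0 ?lee_fin ?expR_ge0.
- by apply: emeasurable_funD => //; exact: measurable_funeM.
- by move=> w _; rewrite adde_ge0 ?mule_ge0 ?lee_fin ?sqr_ge0.
- by apply: emeasurable_funD => //; exact: measurable_funeM.
apply: filterS U0 => w Uw _.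
rewrite (gtr0_norm Uw) -!EFinM -!EFinD lee_fin -exprMn.
set x := l * U w; have x0 : 0 <= x by rewrite mulr_ge0// ltW.
(* [exp(-x) <= 1 / (1 + x)] and [(1 - x + x^2) (1 + x) = 1 + x^3] *)
rewrite -lerBrDr expRN.
apply: (@le_trans _ _ (1 + x)^-1).
  by rewrite lef_pV2 ?posrE ?expR_gt0 ?expR_ge1Dx// ltr_wpDr.
have x1 : 0 < 1 + x by rewrite ltr_wpDr.
rewrite -div1r ler_pdivrMr// (_ : _ * _ = 1 + x ^+ 3); last by ring.
by rewrite lerDl exprn_ge0.
Qed.

Lemma expectation_ae_gt0 (U : {RV P >-> R}) :
  {ae P, forall w, 0 < U w} -> ('E_P[U] = \int[P]_w (`|U w|)%:E)%E.
Proof.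
move=> U0; rewrite unlock; apply: ae_eq_integral => //.
- by apply/measurable_EFinP.
- by apply/measurable_EFinP; exact: measurableT_comp.
- by apply: filterS U0 => w Uw _; rewrite gtr0_norm.
Qed.

(** A zero integral would make [U] vanish almost everywhere; being also positive almost everywhere,
    it would make the whole space a null set. *)
Lemma integral_abs_gt0 (U : {RV P >-> R}) :
  {ae P, forall w, 0 < U w} -> (0 < \int[P]_w (`|U w|)%:E)%E.
Proof.
move=> U0; rewrite lt0e; apply/andP; split; last first.
  by apply: integral_ge0 => w _; rewrite lee_fin.
apply/eqP => int0.
have mU : measurable_fun [set: Omega] (EFin \o U) by exact/measurable_EFinP.
have /(_ int0) U00 := (ae_eq_integral_abs P measurableT mU).1.
have : {ae P, forall w : Omega, False}.
  apply: filterS2 U0 U00 => w Uw /(_ I) /= [Uw0].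
  by rewrite Uw0 ltxx in Uw.
move=> [N [mN N0 subN]].
have NT : N = [set: Omega] by apply/seteqP; split=> // w _; exact: subN.
have := probability_setT P; rewrite -NT => N1.
by move: N0; rewrite N1 => /eqP; rewrite onee_eq0.
Qed.

Lemma integral_abs_lty (U : {RV P >-> R}) :
  (\int[P]_w (U w ^+ 2)%:E < +oo)%E -> (\int[P]_w (`|U w|)%:E < +oo)%E.
Proof.
move=> U2oo; apply: (@le_lt_trans _ _ (\int[P]_w (cst 1 w + (U w ^+ 2)%:E))%E).
  apply: ge0_le_integralT => w; first by rewrite lee_fin.
  rewrite -EFinD lee_fin -[U w ^+ 2]real_normK ?num_real//.
  (* The square gives [2 |u| <= 1 + u^2], and the constant 1 is integrable for a probability. *)
  have := sqr_ge0 (`|U w| - 1); nra.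
rewrite ge0_integralD//; last 2 first.
- by move=> w _; rewrite lee_fin sqr_ge0.
- by apply/measurable_EFinP; exact: measurable_funX.
by rewrite integral_cst// mul1e [X in (X + _)%E](@probability_setT _ _ _ P) lte_add_pinfty// ltry.
Qed.

Lemma scaled_laplace (Y U : {RV P >-> R}) (a l : R) :
  same_distribution P (Y : Omega -> R) (fun w => a * U w) ->
  (\int[P]_w (expR (- (l * Y w)))%:E = \int[P]_w (expR (- (l * a * U w)))%:E)%E.
Proof.
(* [V] presents [a * U] as a measurable function, as the transfer between equal laws requires. *)
move=> YU; pose V : {mfun Omega >-> R} := cst a \* U.
have YV : same_distribution P (Y : Omega -> R) V by exact: YU.
rewrite (same_distribution_integral _ _ _ _ (EFin \o (fun x => expR (- (l * x)))) YV).
- by apply: eq_integral => w _; rewrite /= mulrA.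
- by apply/measurable_EFinP; exact: measurable_expRN.
- by move=> x; rewrite lee_fin expR_ge0.
Qed.

End time_steps.

(* The right-hand side is the minimum over [l] of the Chernoff bound, attained at [l = j k / T]. *)
Lemma chernoff_optimum (R : realType) (T C k e : R) (j : nat) :
  0 < T -> 0 < C -> 0 < k -> 0 < e -> (1 <= j)%N ->
  expR (j%:R * k / T * T) * (C / (j%:R * k / T * e) `^ k) ^+ j =
  ((expR 1 * T * C `^ k^-1) / (j%:R * k * e)) `^ (j%:R * k).
Proof.
move=> T0 C0 k0 e0 j1; have j0 : 0 < j%:R :> R by rewrite ltr0n.
(* Here [e] stands for [eps ^+ 2] and Euler's number is [expR 1]; [l] is the optimal parameter after
   rescaling to [U]. *)
set l := j%:R * k / T * e; have l0 : 0 < l by rewrite !mulr_gt0 ?invr_gt0.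
have Ck0 : 0 < C `^ k^-1 by exact: powR_gt0.
have -> : expR 1 * T * C `^ k^-1 / (j%:R * k * e) = expR 1 * (C `^ k^-1 * l^-1).
  by rewrite /l; field; rewrite ?gt_eqF.
move: (ltW l0) (ltW Ck0); clearbody l => l0' Ck0'.
rewrite powRM ?expR_ge0 ?mulr_ge0 ?invr_ge0// powRM ?invr_ge0//.
rewrite -expRM mul1r divfK ?gt_eqF//; congr (_ * _); rewrite exprMn; congr (_ * _).
  by rewrite -powRrM mulrCA mulVf ?gt_eqF// mulr1 powR_mulrn// ltW.
rewrite [j%:R * k]mulrC powRrM powR_mulrn ?powR_ge0//; congr (_ ^+ _).
by rewrite -powRN -[l^-1]powR_inv1// -powRrM mulN1r.
Qed.

(** * Proof of the two bounds *)

Theorem proposition1p1 (R : realType) (d : measure_display)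
  (Omega : measurableType d) (P : probability Omega R)
  (T : R) (T_gt0 : 0 < T)
  (U : {RV P >-> R}) (U_gt0 : {ae P, forall w, 0 < U w})
  (Ueps : R -> nat -> {RV P >-> R})
  (Ueps_iid : forall eps : R, 0 < eps ->
     iid P (fun n => Ueps eps n : Omega -> R))
  (Ueps_law : forall eps : R, 0 < eps ->
     same_distribution P (Ueps eps 0%N) (fun w => eps ^+ 2 * U w)) :
  (forall C kappa : R, 0 < C -> 0 < kappa ->
     (forall lambda : R, 0 < lambda ->
        ('E_P[(fun w => (expR (- (lambda * U w)))%R)] <=
           (C / lambda `^ kappa)%:E)%E) ->
     forall eps : R, 0 < eps ->
     forall j : nat, (1 <= j)%N ->
       (P [set w | ((j%:R)%:E < num_steps (Ueps eps) T w)%E] <=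
         (((expR 1 * T * C `^ kappa^-1) / (j%:R * kappa * eps ^+ 2))
            `^ (j%:R * kappa))%:E)%E)
  /\
  (('E_P[(fun w => (U w ^+ 2)%R)] < +oo)%E ->
   forall delta : R, 1 < delta ->
   exists eps0 : R, 0 < eps0 /\
     forall eps : R, 0 < eps -> eps <= eps0 ->
       (\int[P]_w num_steps (Ueps eps) T w <=
         ((delta * expR 1 * T) / (eps ^+ 2 * fine 'E_P[U]))%:E)%E).
Proof.
split=> [C k C0 k0 lapU eps eps0 j j1|U2oo delta delta1].
  have e20 : 0 < eps ^+ 2 by exact: exprn_gt0.
  pose l := j%:R * k / T.
  have l0 : 0 < l by rewrite !mulr_gt0 ?invr_gt0// ltr0n.
  (* The Laplace transform of the first step at [l] is that of [U] at [l * eps ^+ 2]. *)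
  have := lapU (l * eps ^+ 2) (mulr_gt0 l0 e20).
  rewrite unlock -(scaled_laplace _ _ _ _ _ (Ueps_law eps eps0)).
  set phi := (\int[P]_w _)%E => phi_le.
  have phi0 : (0 <= phi)%E by apply: integral_ge0 => w _; rewrite lee_fin expR_ge0.
  have phiE : phi = (fine phi)%:E.
    by rewrite fineK// ge0_fin_numE// (le_lt_trans phi_le)// ltry.
  apply: le_trans (prob_lt_num_steps_le _ _ _ _ T j (Ueps_iid eps eps0) phiE (ltW l0) j1) _.
  rewrite lee_fin -chernoff_optimum// ler_pM2l ?expR_gt0//.
  have phi_le' : fine phi <= C / (l * eps ^+ 2) `^ k by rewrite -lee_fin -phiE.
  by rewrite lerXn2r// nnegrE ?fine_ge0// divr_ge0 ?powR_ge0// ltW.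
rewrite unlock in U2oo.
have m0 := integral_abs_gt0 _ _ U_gt0.
have moo := integral_abs_lty _ _ U2oo.
rewrite (expectation_ae_gt0 _ _ U_gt0).
have lapU := fun l l0 => laplace_le_quadratic P U l l0 U_gt0.
move: m0 moo lapU; set mE := (\int[P]_w _)%E => m0 moo lapU.
have mEE : mE = (fine mE)%:E by rewrite fineK// ge0_fin_numE// ltW.
move: U2oo lapU; set qE := (\int[P]_w (_ ^+ 2)%:E)%E => qoo lapU.
have q0 : (0 <= qE)%E by apply: integral_ge0 => w _; rewrite lee_fin sqr_ge0.
have qEE : qE = (fine qE)%:E by rewrite fineK// ge0_fin_numE.
move: m0 q0 lapU; rewrite mEE qEE lte_fin lee_fin; move: (fine mE) (fine qE) => m q m0 q0 lapU.
have dT0 : 0 < delta by rewrite (lt_trans _ delta1).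
(* [m] and [q] are the first two moments of [U]. With [x = eps^2 / T], the bound [eps^2 <= b] says
   exactly [x (q + 1) <= m (1 - 1/delta)]; adding 1 makes the denominator positive from [q >= 0]
   alone. *)
pose b := T * m * (1 - delta^-1) / (q + 1).
have b0 : 0 < b.
  by rewrite !mulr_gt0 ?invr_gt0 ?subr_gt0 ?invf_lt1// ltr_wpDl.
exists (Num.sqrt b); split=> [|eps eps0 epsb]; first by rewrite sqrtr_gt0.
have e20 : 0 < eps ^+ 2 by exact: exprn_gt0.
have e2b : eps ^+ 2 <= b.
  have <- : Num.sqrt b ^+ 2 = b by rewrite sqr_sqrtr// ltW.
  by rewrite ler_sqr// nnegrE ?sqrtr_ge0// ltW.
have l0 : 0 <= T^-1 by rewrite invr_ge0 ltW.
have := lapU (T^-1 * eps ^+ 2) (mulr_ge0 l0 (ltW e20)).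
rewrite -(scaled_laplace _ _ _ _ _ (Ueps_law eps eps0)).
set phi := (\int[P]_w _)%E => phi_le.
have phi0 : (0 <= phi)%E by apply: integral_ge0 => w _; rewrite lee_fin expR_ge0.
(* Finite because [phi_le] bounds [phi] plus a real number by a real number. *)
have phiE : phi = (fine phi)%:E.
  by move: phi_le phi0; rewrite -!EFinM -EFinD; case: phi.
move: phi_le; rewrite phiE -!EFinM -!EFinD lee_fin => phi_le.
set x := T^-1 * eps ^+ 2 in phi_le.
have x0 : 0 < x by rewrite mulr_gt0// invr_gt0.
have xq : x * q <= m * (1 - delta^-1).
  apply: (@le_trans _ _ (x * (q + 1))); first by rewrite ler_pM2l// lerDl.
  rewrite -ler_pdivlMr ?ltr_wpDl// /x mulrC ler_pdivrMr//.
  apply: (le_trans e2b); rewrite /b le_eqVlt; apply/orP; left; apply/eqP; field.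
  by rewrite !gt_eqF ?ltr_wpDl.
(* The quadratic error [x^2 q] uses up at most the fraction [1 - 1/delta] of the main term [x m]. *)
have gap : x * m / delta <= 1 - fine phi.
  have := ler_wpM2l (ltW x0) xq; clear -phi_le; clearbody x.
  by rewrite mulrBr mulr1 mulrBr; lra.
have gap0 : 0 < x * m / delta by rewrite !mulr_gt0 ?invr_gt0.
apply: le_trans (integral_num_steps_le _ _ _ _ T (Ueps_iid eps eps0) phiE _ l0 (ltW T_gt0)) _.
  by rewrite -subr_gt0 (lt_le_trans gap0).
(* The choice [l = 1/T] turns [exp(l T)] into Euler's number. *)
rewrite lee_fin mulVf ?gt_eqF//.
apply: (@le_trans _ _ (expR 1 / (x * m / delta))).
  by rewrite ler_pM2l ?expR_gt0// lef_pV2 ?posrE ?(lt_le_trans gap0).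
rewrite le_eqVlt; apply/orP; left; apply/eqP; rewrite /x /=; field.
by rewrite ?gt_eqF.
Qed.
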